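(* Let $(N,J,h)$ be an almost anti-Hermitian manifold and let $\nabla$ be a linear connection on $N$ with torsion tensor $T^{\nabla}$. Suppose that $d^{\nabla}J=0$ and $d^{\nabla}h=0$. Then $(N,J,h)$ is an anti-Kähler manifold if and only if $$h\big(T^{\nabla}(JX,Z),Y\big)=-h\big((\nabla_YJ)Z,X\big)$$ for all vector fields $X,Y,Z$ on $N$.
   Context: An almost anti-Hermitian (Norden) manifold $(N,J,h)$ is a $2n$-dimensional smooth manifold $N$ with an almost complex structure $J$ ($J^2=-\mathrm{id}$) and a pseudo-Riemannian metric $h$ (necessarily of neutral signature $(n,n)$) such that $h(JX,Y)=h(X,JY)$ for all vector fields $X,Y$. It is anti-Kähler if $\nabla^hJ=0$, where $\nabla^h$ is the Levi-Civita connection of $h$. For a linear connection $\nabla$: $T^{\nabla}(X,Y)=\nabla_XY-\nabla_YX-[X,Y]$; $(\nabla_XJ)Y=\nabla_X(JY)-J\nabla_XY$; $(d^{\nabla}J)(X,Y)=(\nabla_XJ)Y-(\nabla_YJ)X+J\,T^{\nabla}(X,Y)$; and $(d^{\nabla}h)(X,Y,Z)=(\nabla_Xh)(Y,Z)-(\nabla_Yh)(X,Z)+h(T^{\nabla}(X,Y),Z)$. *)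

(* Defs.v *)
From HB Require Import structures.
From mathcomp Require Import all_boot all_order all_algebra.
From mathcomp Require Import all_classical all_reals all_analysis.
From mathcomp Require Import ring.

Set Implicit Arguments.
Unset Strict Implicit.
Unset Printing Implicit Defensive.

Import Order.TTheory GRing.Theory Num.Theory numFieldNormedType.Exports.

Local Open Scope classical_set_scope.
Local Open Scope ring_scope.

Section Ck.
Context {R : realType} {V W : normedModType R}.

(* Values of f outside of U are irrelevant when U is open: differentiability
   and directional derivatives at a point of U only depend on f near it. *)
Fixpoint Ck (k : nat) (U : set V) (f : V -> W) : Prop :=
  if k is k'.+1 then
    (forall x, U x -> differentiable f x) /\
    (forall v, Ck k' U (fun x => 'D_v f x))
  else forall x, U x -> {for x, continuous f}.

Definition smooth_on (U : set V) (f : V -> W) : Prop := forall k, Ck k U f.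

Lemma near_eq_differentiable (f g : V -> W) (x : V) :
  (\near x, f x = g x) -> differentiable f x -> differentiable g x.
Proof.
move=> fg df; have dfc := diff_continuous df.
have dgE : g \o shift x = cst (g x) + 'd f x +o_ 0 id.
  apply/eqaddoP => e e0; have /eqaddoP /(_ e e0) := diff_locally df.
  have fgx : f x = g x by exact: nbhs_singleton fg.
  have : \forall h \near (0 : V), f (h + x) = g (h + x).
    by move: fg; rewrite (near_shift 0 x) subr0.
  move=> fg0 H; near=> h.
  have -> : (g \o shift x - (cst (g x) + 'd f x)) h =
            (f \o shift x - (cst (f x) + 'd f x)) h.
    by rewrite /= -fgx /GRing.add /GRing.opp/= (near fg0 h).
  by near: h.
have dgf := diff_unique dfc dgE.
by apply/diff_locallyP; rewrite dgf.
Unshelve. all: by end_near. Qed.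

Lemma eq_Ck k (U : set V) (f g : V -> W) : open U ->
  (forall x, U x -> f x = g x) -> Ck k U f -> Ck k U g.
Proof.
elim: k f g => [|k IH] f g oU fg; have nfg x : U x -> \near x, f x = g x.
- by move=> Ux; near=> y; apply: fg; near: y; exact: open_nbhs_nbhs.
- move=> fU x Ux; rewrite /prop_for /continuous_at -(fg x Ux).
  apply: cvg_trans (fU x Ux); apply: near_eq_cvg.
  by apply: filterS (nfg x Ux) => y ->.
- by move=> Ux; near=> y; apply: fg; near: y; exact: open_nbhs_nbhs.
move=> [df Df]; split=> [x Ux|v].
  by apply: near_eq_differentiable (df _ Ux); exact: nfg.
apply: IH (Df v) => // x Ux.
by apply: near_eq_derive; exact: nfg.
Unshelve. all: by end_near. Qed.

Lemma CkW k (U : set V) (f : V -> W) : Ck k.+1 U f -> Ck k U f.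
Proof.
elim: k f => [|k IH] f [df Df]; last by split=> // v; apply: IH; exact: Df.
by move=> x Ux; exact/differentiable_continuous/df.
Qed.

Lemma Ck_cst k (U : set V) (c : W) : open U -> Ck k U (fun=> c).
Proof.
move=> oU; elim: k c => [|k IH] c /=; first by move=> x _; exact: cvg_cst.
split=> [x _|v]; first exact: differentiable_cst.
apply: eq_Ck (IH 0) => // x _; exact/esym/derive_cst.
Qed.

Lemma CkD k (U : set V) (f g : V -> W) : open U ->
  Ck k U f -> Ck k U g -> Ck k U (f + g).
Proof.
move=> oU; elim: k f g => [|k IH] f g /=.
  by move=> fU gU x Ux; apply: continuousD; [exact: fU|exact: gU].
move=> [df Df] [dg Dg]; split=> [x Ux|v].
  by apply: differentiableD; [exact: df|exact: dg].
apply: eq_Ck (IH _ _ (Df v) (Dg v)) => // x Ux.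
by rewrite deriveD//; apply: diff_derivable; [exact: df|exact: dg].
Qed.

End Ck.

Lemma CkM (R : realType) (V : normedModType R) k (U : set V) (f g : V -> R) :
  open U -> Ck k U f -> Ck k U g -> Ck k U (f * g).
Proof.
move=> oU; elim: k f g => [|k IH] f g.
  by move=> fU gU x Ux; apply: continuousM; [exact: fU|exact: gU].
move=> fC gC; have [fk gk] := (CkW fC, CkW gC).
have [[df Df] [dg Dg]] := (fC, gC); split=> [x Ux|v].
  by apply: differentiableM; [exact: df|exact: dg].
have := CkD oU (IH _ _ fk (Dg v)) (IH _ _ gk (Df v)).
apply: eq_Ck => // x Ux.
by rewrite deriveM//; apply: diff_derivable; [exact: df|exact: dg].
Qed.

(* A homeomorphism from the open set [chart_dom] of M onto an open subset of
   R^m; [chart_inv] is only meaningful on the image of [chart_dom]. *)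
Record chart (R : realType) (m : nat) (M : topologicalType) := Chart {
  chart_dom : set M;
  chart_map : M -> 'rV[R]_m;
  chart_inv : 'rV[R]_m -> M;
  chart_dom_open : open chart_dom;
  chart_cod_open : open (chart_map @` chart_dom);
  chart_mapK : forall p, chart_dom p -> chart_inv (chart_map p) = p;
  chart_map_continuous :
    forall p, chart_dom p -> {for p, continuous chart_map};
  chart_inv_continuous :
    forall x, (chart_map @` chart_dom) x -> {for x, continuous chart_inv} }.

(* The atlas need not be maximal. *)
Record manifold (R : realType) (m : nat) := Manifold {
  carrier :> topologicalType;
  chart_index : Type;
  atlas : chart_index -> chart R m carrier;
  manifold_hausdorff : hausdorff_space carrier;
  manifold_second_countable : @second_countable carrier;
  atlas_cover : forall p : carrier, exists i, chart_dom (atlas i) p;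
  atlas_smooth : forall i j,
    smooth_on (chart_map (atlas i) @` (chart_dom (atlas i) `&` chart_dom (atlas j)))
      (chart_map (atlas j) \o chart_inv (atlas i)) }.

Section SmoothFunctions.
Context {R : realType} {m : nat} (N : manifold R m).

Definition smooth (f : N -> R) : Prop := forall i : chart_index N,
  smooth_on (chart_map (atlas i) @` chart_dom (atlas i))
    (f \o chart_inv (atlas i)).

Definition smooth_pred : pred (N -> R) := fun f => `[< smooth f >].

Lemma smooth_predP f : reflect (smooth f) (f \in smooth_pred).
Proof. exact: asboolP. Qed.

Lemma smooth_cst (c : R) : smooth (fun=> c).
Proof. by move=> i k; apply: Ck_cst; exact: chart_cod_open. Qed.

Lemma smoothD f g : smooth f -> smooth g -> smooth (f + g).
Proof.
by move=> fs gs i k; apply: CkD (fs i k) (gs i k); exact: chart_cod_open.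
Qed.

Lemma smoothM f g : smooth f -> smooth g -> smooth (f * g).
Proof.
by move=> fs gs i k; apply: CkM (fs i k) (gs i k); exact: chart_cod_open.
Qed.

Lemma smoothZ (c : R) f : smooth f -> smooth (c *: f).
Proof. by move=> fs; exact: smoothM (smooth_cst c) fs. Qed.

Lemma smooth_subring_closed : subring_closed smooth_pred.
Proof.
split=> [|f g|f g]; first exact/smooth_predP/smooth_cst.
- move=> /smooth_predP fs /smooth_predP gs; apply/smooth_predP.
  by rewrite -scaleN1r; exact/smoothD/smoothZ.
- by move=> /smooth_predP fs /smooth_predP gs; exact/smooth_predP/smoothM.
Qed.

Lemma smooth_submod_closed : submod_closed smooth_pred.
Proof.
split=> [|a f g]; first exact/smooth_predP/smooth_cst.
move=> /smooth_predP fs /smooth_predP gs; apply/smooth_predP.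
exact/smoothD/gs/smoothZ.
Qed.

Record Cinf := MkCinf { Cinf_fun :> N -> R; _ : Cinf_fun \in smooth_pred }.

HB.instance Definition _ := [isSub for Cinf_fun].
HB.instance Definition _ := gen_eqMixin Cinf.
HB.instance Definition _ := gen_choiceMixin Cinf.
HB.instance Definition _ := 
  GRing.SubChoice_isSubComPzRing.Build _ _ Cinf smooth_subring_closed.
HB.instance Definition _ := 
  GRing.SubZmodule_isSubLmodule.Build R _ _ Cinf smooth_submod_closed.

End SmoothFunctions.

Section VectorFields.
Context {R : realType} {m : nat} (N : manifold R m).
Local Notation C := (Cinf N).

(* On a Hausdorff second countable manifold, smooth vector fields are the
   derivations of the algebra of smooth functions; tensor fields are then the
   maps that are multilinear over that algebra. *)
Record vfield := VField {
  vfield_fun :> C -> C;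
  vfield_linear : linear vfield_fun;
  vfield_leibniz : forall f g : C,
    vfield_fun (f * g) = vfield_fun f * g + f * vfield_fun g }.

HB.instance Definition _ := gen_eqMixin vfield.
HB.instance Definition _ := gen_choiceMixin vfield.

Implicit Types (X Y Z : vfield) (f g : C).

Lemma vfieldP X Y : (forall f, X f = Y f) -> X = Y.
Proof.
case: X Y => [X lX dX] [Y lY dY] /= /funext XY; move: lX dX lY dY.
by rewrite XY => *; congr VField; exact: Prop_irrelevance.
Qed.

Lemma Cinf_scaleE (a : R) f g : (a *: f) * g = a *: (f * g).
Proof. by apply/val_inj/funext => p; exact/esym/mulrA. Qed.

Let Cinf_scalerAr (a : R) f g : f * (a *: g) = a *: (f * g).
Proof. by rewrite mulrC Cinf_scaleE mulrC. Qed.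

Fact vfield0_linear : linear (fun _ : C => 0 : C).
Proof. by move=> a f g; rewrite scaler0 addr0. Qed.
Fact vfield0_leibniz f g : 0 = 0 * g + f * 0 :> C.
Proof. by rewrite mul0r mulr0 addr0. Qed.
Definition vfield0 := VField vfield0_linear vfield0_leibniz.

Fact vfieldD_linear X Y : linear (fun f => X f + Y f).
Proof.
by move=> a f g; rewrite !vfield_linear scalerDr addrACA.
Qed.
Fact vfieldD_leibniz X Y f g :
  X (f * g) + Y (f * g) = (X f + Y f) * g + f * (X g + Y g).
Proof. by rewrite !vfield_leibniz mulrDl mulrDr addrACA. Qed.
Definition vfieldD X Y := VField (vfieldD_linear X Y) (vfieldD_leibniz X Y).

Fact vfieldZ_linear (k : C) X : linear (fun f => k * X f).
Proof. by move=> a f g; rewrite vfield_linear mulrDr Cinf_scalerAr. Qed.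
Fact vfieldZ_leibniz (k : C) X f g :
  k * X (f * g) = (k * X f) * g + f * (k * X g).
Proof. by rewrite vfield_leibniz mulrDr mulrA (mulrCA f). Qed.
Definition vfieldZ k X := VField (vfieldZ_linear k X) (vfieldZ_leibniz k X).

Definition vfieldN X := vfieldZ (-1) X.

Fact vfieldDA : associative vfieldD.
Proof. by move=> X Y Z; apply: vfieldP => f /=; rewrite addrA. Qed.
Fact vfieldDC : commutative vfieldD.
Proof. by move=> X Y; apply: vfieldP => f /=; rewrite addrC. Qed.
Fact vfield0D : left_id vfield0 vfieldD.
Proof. by move=> X; apply: vfieldP => f /=; rewrite add0r. Qed.
Fact vfieldND : left_inverse vfield0 vfieldN vfieldD.
Proof. by move=> X; apply: vfieldP => f /=; rewrite mulN1r addNr. Qed.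

HB.instance Definition _ :=
  GRing.isZmodule.Build vfield vfieldDA vfieldDC vfield0D vfieldND.

Fact vfieldZA f g X : vfieldZ f (vfieldZ g X) = vfieldZ (f * g) X.
Proof. by apply: vfieldP => k /=; rewrite mulrA. Qed.
Fact vfield1Z : left_id 1 vfieldZ.
Proof. by move=> X; apply: vfieldP => f /=; rewrite mul1r. Qed.
Fact vfieldZDr : right_distributive vfieldZ +%R.
Proof. by move=> k X Y; apply: vfieldP => f /=; rewrite mulrDr. Qed.
Fact vfieldZDl X : {morph vfieldZ^~ X : f g / f + g}.
Proof. by move=> f g; apply: vfieldP => k /=; rewrite mulrDl. Qed.

HB.instance Definition _ := GRing.Zmodule_isLmodule.Build C vfield
  vfieldZA vfield1Z vfieldZDr vfieldZDl.

Fact bracket_linear X Y : linear (fun f => X (Y f) - Y (X f)).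
Proof.
by move=> a f g; rewrite !vfield_linear scalerBr opprD addrACA.
Qed.
Fact bracket_leibniz X Y f g :
  X (Y (f * g)) - Y (X (f * g)) =
  (X (Y f) - Y (X f)) * g + f * (X (Y g) - Y (X g)).
Proof.
have XD (Z : vfield) u v : Z (u + v) = Z u + Z v.
  by have := vfield_linear Z 1 u v; rewrite !scale1r.
by rewrite !(vfield_leibniz, XD); ring.
Qed.
Definition bracket X Y := VField (bracket_linear X Y) (bracket_leibniz X Y).

End VectorFields.

Section Connections.
Context {R : realType} {m : nat} (N : manifold R m).
Local Notation C := (Cinf N).
Local Notation VF := (vfield N).

(* Nondegeneracy is fibrewise: the tangent vector X_p, i.e. the map
   f |-> X f p, vanishes as soon as it is h_p-orthogonal to every Y_p. *)
Record pseudo_riemannian := PseudoRiemannian {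
  prmetric_fun :> VF -> VF -> C;
  prmetric_linear : forall Z, scalar (prmetric_fun^~ Z);
  prmetric_sym : forall X Y, prmetric_fun X Y = prmetric_fun Y X;
  prmetric_nondegenerate : forall (p : N) (X : VF),
    (forall Y : VF, prmetric_fun X Y p = 0) -> forall f : C, X f p = 0 }.

Record connection := Connection {
  connection_fun :> VF -> VF -> VF;
  connection_linear : forall Y, linear (connection_fun^~ Y);
  connection_additive : forall X Y Z,
    connection_fun X (Y + Z) = connection_fun X Y + connection_fun X Z;
  connection_leibniz : forall X (f : C) Y,
    connection_fun X (f *: Y) = X f *: Y + f *: connection_fun X Y }.

Implicit Types (D : connection) (J : {linear VF -> VF}) (h : pseudo_riemannian).
Implicit Types (X Y Z : VF).

Definition torsion D X Y : VF := D X Y - D Y X - bracket X Y.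

(* (D_X J) Y; the tensor D J vanishes iff [parallel D J] below. *)
Definition nablaJ D J X Y : VF := D X (J Y) - J (D X Y).

(* (D_X h)(Y, Z) *)
Definition nablah D h X Y Z : C := X (h Y Z) - h (D X Y) Z - h Y (D X Z).

Definition dJ D J X Y : VF :=
  nablaJ D J X Y - nablaJ D J Y X + J (torsion D X Y).

Definition dh D h X Y Z : C :=
  nablah D h X Y Z - nablah D h Y X Z + h (torsion D X Y) Z.

Definition almost_complex J : Prop := forall X, J (J X) = - X.

Definition almost_anti_hermitian J h : Prop :=
  almost_complex J /\ forall X Y, h (J X) Y = h X (J Y).

(* Nondegeneracy of h makes such a D unique. *)
Definition levi_civita h D : Prop :=
  (forall X Y, torsion D X Y = 0) /\ (forall X Y Z, nablah D h X Y Z = 0).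

Definition parallel D J : Prop := forall X Y, nablaJ D J X Y = 0.

End Connections.

(* Main.v *)
Require Import Defs.
From mathcomp Require Import all_boot all_order all_algebra.
From mathcomp Require Import all_classical all_reals all_analysis.
From mathcomp Require Import ring.

(** Let [L] be the Levi-Civita connection and [S := nabla - L].  Since [L] is
    torsion free and metric, [d^nabla h = 0] says that [h (S X Z) Y] is symmetric
    in [X] and [Y].  With this symmetry and [d^nabla J = 0], the displayed
    condition becomes, for [a X Y Z := h ((L_X J) Y) Z],
    [a X Z Y = a Z X Y + a Y Z X] for all [X], [Y], [Z].  As [J] is
    [h]-self-adjoint, [a] is symmetric in its last two arguments, so adding the
    same identity with [X] and [Z] exchanged gives [2 a Y X Z = 0], and
    nondegeneracy of [h] yields [L J = 0]. *)

Set Implicit Arguments.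
Unset Strict Implicit.
Unset Printing Implicit Defensive.

Import GRing.Theory.

Local Open Scope ring_scope.

Section Metric.
Context {R : realType} {m : nat} {N : manifold R m} (h : pseudo_riemannian N).
Local Notation VF := (vfield N).
Implicit Types (X Y Z : VF) (D L : connection N).

Lemma prmetricBl X Y Z : h (X - Y) Z = h X Z - h Y Z.
Proof. by rewrite addrC -scaleN1r prmetric_linear mulN1r addrC. Qed.

Lemma prmetricNl X Z : h (- X) Z = - h X Z.
Proof. by rewrite -[- X]sub0r -(subrr X) !prmetricBl; ring. Qed.

Lemma prmetricDl X Y Z : h (X + Y) Z = h X Z + h Y Z.
Proof. by rewrite -[Y in LHS]opprK prmetricBl prmetricNl opprK. Qed.

Lemma prmetric0l Z : h 0 Z = 0.
Proof. by rewrite -(subrr 0) prmetricBl subrr. Qed.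

Lemma prmetric_inj X : (forall Y, h X Y = 0) -> X = 0.
Proof.
move=> hX0; apply: vfieldP => f; apply/val_inj/funext => p.
by apply: (prmetric_nondegenerate (p0 := h)) => Y; rewrite hX0.
Qed.

Lemma prmetric_derive L X Y Z : levi_civita h L ->
  X (h Y Z) = h (L X Y) Z + h (L X Z) Y.
Proof.
case=> _ /(_ X Y Z); rewrite /nablah [h Y (L X Z)]prmetric_sym => /eqP.
by rewrite -addrA -opprD subr_eq0 => /eqP.
Qed.

Lemma levi_civita_bracket L X Y : levi_civita h L ->
  bracket X Y = L X Y - L Y X.
Proof. by case=> /(_ X Y) /eqP; rewrite subr_eq0 => /eqP. Qed.

(** Differentiate the symmetric form [h (J Y) Z] along [X], using that [L] is metric. *)
Lemma nablaJ_levi_civita_sym (J : {linear VF -> VF}) L X Y Z :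
    levi_civita h L -> (forall X Y, h (J X) Y = h X (J Y)) ->
  h (nablaJ L J X Y) Z = h (nablaJ L J X Z) Y.
Proof.
move=> hL hJ; have hJYZ : X (h (J Y) Z) = X (h (J Z) Y).
  by rewrite hJ prmetric_sym.
move: hJYZ; rewrite !(prmetric_derive _ _ _ hL) !prmetricBl !hJ => e.
by apply/eqP; rewrite subr_eq addrAC eq_sym subr_eq e.
Qed.

Lemma Cinf_double_eq0 (a : Cinf N) : a + a = 0 -> a = 0.
Proof.
move=> aa0; apply/val_inj/funext => p.
have /eqP : a p + a p = 0 by exact: (congr1 (fun f : Cinf N => f p) aa0).
by rewrite -mulr2n Num.Theory.mulrn_eq0 /= => /eqP.
Qed.

Section Difference.
Variables (D L : connection N).
Hypothesis hL : levi_civita h L.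

Let S X Y : VF := D X Y - L X Y.

(** Since [L] is metric and torsion free, the torsion term of [dh] cancels [h (S X Y) Z] and
    [h (S Y X) Z], leaving [h (S Y Z) X - h (S X Z) Y]. *)
Lemma dh_eq0_difference_sym X Y Z : dh D h X Y Z = 0 ->
  h (S X Z) Y = h (S Y Z) X.
Proof.
rewrite /dh /nablah /torsion !(prmetric_derive _ _ _ hL).
rewrite (levi_civita_bracket _ _ hL) !prmetricBl.
rewrite [h Y (D X Z)]prmetric_sym [h X (D Y Z)]prmetric_sym => e.
by apply/eqP; rewrite -subr_eq0 -oppr_eq0 -[X in _ == X]e; apply/eqP; ring.
Qed.

Lemma torsion_difference X Y Z : h (torsion D X Y) Z = h (S X Y) Z - h (S Y X) Z.
Proof. by rewrite /torsion (levi_civita_bracket _ _ hL) !prmetricBl; ring. Qed.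

Lemma nablaJ_difference (J : {linear VF -> VF}) X Y Z :
  h (nablaJ D J X Y) Z =
  h (nablaJ L J X Y) Z + h (S X (J Y)) Z - h (J (S X Y)) Z.
Proof. by rewrite /nablaJ /S (linearB J) !prmetricBl; ring. Qed.

(** The terms [J (S X Y)] and [J (S Y X)] from the two [nablaJ] cancel against [J] of the
    torsion. *)
Lemma dJ_difference (J : {linear VF -> VF}) X Y Z :
  h (dJ D J X Y) Z = h (nablaJ L J X Y) Z - h (nablaJ L J Y X) Z
    + h (S X (J Y)) Z - h (S Y (J X)) Z.
Proof.
rewrite /dJ prmetricDl prmetricBl !nablaJ_difference /torsion.
by rewrite (levi_civita_bracket _ _ hL) /S !(linearB J) !prmetricBl; ring.
Qed.

Lemma torsion_nablaJ_difference (J : {linear VF -> VF}) X Y Z :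
    (forall X Y, h (J X) Y = h X (J Y)) ->
    (forall X Y, dJ D J X Y = 0) -> (forall X Y Z, dh D h X Y Z = 0) ->
  h (torsion D (J X) Z) Y + h (nablaJ D J Y Z) X =
  h (nablaJ L J Y Z) X + h (nablaJ L J Z X) Y - h (nablaJ L J X Z) Y.
Proof.
move=> hJ dJ0 dh0; have := dJ_difference J X Z Y; rewrite dJ0 prmetric0l => e.
rewrite torsion_difference nablaJ_difference hJ.
(* This makes [h (S (J X) Z) Y] cancel [h (S Y Z) (J X)]; the next swap yields [h (S X (J Z)) Y], so
   that the remaining [S] terms are exactly those of [e]. *)
rewrite (dh_eq0_difference_sym (dh0 (J X) Y Z)).
rewrite (dh_eq0_difference_sym (dh0 Y X (J Z))).
by apply/eqP; rewrite -subr_eq0 [X in _ == X]e; apply/eqP; ring.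
Qed.

End Difference.
End Metric.

Theorem theorem4 (R : realType) (n : nat) (N : manifold R (2 * n)%N)
    (J : {linear vfield N -> vfield N}) (h : pseudo_riemannian N)
    (hN : almost_anti_hermitian J h)
    (* the Levi-Civita connection of h *)
    (nablaLC : connection N) (hLC : levi_civita h nablaLC)
    (nabla : connection N)
    (hJ : forall X Y : vfield N, dJ nabla J X Y = 0)
    (hh : forall X Y Z : vfield N, dh nabla h X Y Z = 0) :
  parallel nablaLC J <->
  (forall X Y Z : vfield N,
     h (torsion nabla (J X) Z) Y = - h (nablaJ nabla J Y Z) X).
Proof.
have [_ hJsym] := hN.
have key X Y Z := torsion_nablaJ_difference hLC X Y Z hJsym hJ hh.
have sym X Y Z := nablaJ_levi_civita_sym X Y Z hLC hJsym.
split=> [LJ X Y Z|cond X Y].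
  by apply/eqP; rewrite -addr_eq0 key !LJ !prmetric0l subr0 addr0.
have {}key U V W : h (nablaJ nablaLC J V W) U + h (nablaJ nablaLC J W U) V
    - h (nablaJ nablaLC J U W) V = 0 by rewrite -key cond addNr.
apply: (@prmetric_inj _ _ _ h) => Z; apply: Cinf_double_eq0.
(* The two instances differ by exchanging [Y] and [Z]: their sum keeps only the terms differentiated
   along [X], which [sym] identifies. *)
rewrite -[RHS]addr0 -{1}(key Z X Y) -(key Y X Z) (sym X Z Y); ring.
Qed.
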